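(* Let $V$ be a nonzero finite-dimensional complex symplectic vector space, $G<\mathrm{Sp}(V)$ a finite subgroup, and $v \in V^*$ such that $R_v$ is finite-dimensional. Let $f_1,\ldots,f_N$ be a homogeneous basis of $R_v$, and let $F_1,\ldots,F_N \in \mathcal{D}_{V^*}$ be lifts of $f_1, \ldots, f_N$ which are homogeneous of degrees $d_1,\ldots,d_N \ge 0$. Let $\xi$ be the Euler vector field and let $C_\xi \in \mathrm{Mat}_N(\mathbb{C})$ be a matrix satisfying $$\bigl(\xi(F_1(g)), \ldots, \xi (F_N(g))\bigr)\big|_{\mathbb{C} \cdot v} = C_\xi \bigl(F_1(g), \ldots, F_N(g)\bigr)\big|_{\mathbb{C} \cdot v}\quad \text{for all } g \in \mathsf{HP}_0(\mathcal{O}_V^G,\mathcal{O}_V)^*.$$ Then, setting $B_\xi := C_\xi - \mathrm{Diag}(d_1,\ldots,d_N)$, $$h(\mathsf{HP}_0(\mathcal{O}_V^G, \mathcal{O}_V)^*;t) \leq \sum_{i \leq 0} \dim E_i(B_\xi)\, t^i ,$$ where $E_i(B_\xi)$ denotes the $i$-eigenspace of $B_\xi$.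
   Context: $\mathcal{O}_V = \mathrm{Sym}(V^* )$ is the algebra of polynomial functions on $V$, with the Poisson bracket induced by the symplectic form and graded by polynomial degree. $\mathcal{O}_{V^*}=\mathrm{Sym}(V)$ is the algebra of polynomial functions on $V^*$, graded nonpositively: elements of $V$ have degree $-1$. $\mathcal{D}_{V^*}$ is the algebra of polynomial differential operators on $V^*$, graded by $\deg u=-1$ for $u\in V$ (multiplication operators) and $\deg\partial_w = 1$ for $w\in V^*$ (differentiation in direction $w$). $F_D:\mathcal{O}_V \to \mathbb{C}[\partial_w : w\in V^*]\subset\mathcal{D}_{V^*}$ is the algebra isomorphism onto constant-coefficient operators on $V^*$ with $w\mapsto \partial_w$ for $w\in V^*$. The graded dual of $\mathcal{O}_V$ is identified with $\mathcal{O}_{V^*}$, $g\in \mathcal{O}_{V^*}$ corresponding to the functional $f\mapsto (F_D(f)g)(0)$. $\mathsf{HP}_0(\mathcal{O}_V^G,\mathcal{O}_V):=\mathcal{O}_V/\{\mathcal{O}_V^G,\mathcal{O}_V\}$, and $\mathsf{HP}_0(\mathcal{O}_V^G,\mathcal{O}_V)^*\subseteq\mathcal{O}_{V^*}$ denotes the (nonpositively graded) space of those $g$ whose functional vanishes on $\{h,f\}$ for all $h\in\mathcal{O}_V^G$, $f\in\mathcal{O}_V$. For $v\in V^*$, let $v'\in V$ correspond to $v$ under the symplectic form and let $D_{v'}$ be the directional derivative on $\mathcal{O}_V$; $J_v\subseteq \mathcal{O}_V$ is the ideal generated by all $D_{v'}h$, $h\in \mathcal{O}_V^G$, regarded (via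 $F_D$) as an ideal of $\mathbb{C}[\partial_w : w\in V^*]$, and $R_v := \mathbb{C}[\partial_w : w\in V^*]/J_v$. A lift of a homogeneous $f_i\in R_v$ is an operator $F_i\in\mathcal{D}_{V^*}$ such that evaluating at the point $v$ the coefficients of the principal symbol of $F_i$ (with respect to the order of differential operators) gives an element of $\mathbb{C}[\partial_w : w\in V^*]$ congruent to $f_i$ modulo $J_v$. The Euler vector field $\xi$ is the one with $\xi(g)=\deg(g)\,g$ for homogeneous $g\in\mathcal{O}_{V^*}$ (with the nonpositive grading). $h(K;t)=\sum_i\dim K_i\,t^i$ and inequalities of series are coefficientwise. *)

(* Defs.v *)
From mathcomp Require Import all_boot all_order all_algebra finmap.
From mathcomp Require Import ssrcomplements mpoly.

Set Implicit Arguments.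
Unset Strict Implicit.
Unset Printing Implicit Defensive.

Import GRing.Theory Num.Theory.

Local Open Scope ring_scope.

(* A symplectic vector space V is given by a basis, that is V = K^n with the
   form omega(x, y) = x^T Om y, and V^* = K^n carries the dual basis.
   Both O_V = Sym(V^* ) and O_{V^*} = Sym(V) are then {mpoly K[n]}: in O_V the
   variable 'X_i is the i-th coordinate function of V, in O_{V^*} it is the
   i-th basis vector of V.  The ring K[d_w : w in V^*] is {mpoly K[n]} as well,
   'X_i being the derivative with respect to the i-th variable of O_{V^*}. *)

Section LinearAlgebra.
Variables (K : fieldType) (L : lmodType K).

Definition basis_of_pred (P : L -> Prop) (d : nat) (b : 'I_d -> L) : Prop :=
  [/\ forall i, P (b i),
      forall c : 'I_d -> K, \sum_i c i *: b i = 0 -> forall i, c i = 0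
    & forall x, P x -> exists c : 'I_d -> K, x = \sum_i c i *: b i].

Definition has_dim (P : L -> Prop) (d : nat) : Prop :=
  exists b : 'I_d -> L, basis_of_pred P b.

(* The classes of the b i form a basis of the quotient L / J. *)
Definition basis_mod (J : L -> Prop) (d : nat) (b : 'I_d -> L) : Prop :=
  (forall c : 'I_d -> K, J (\sum_i c i *: b i) -> forall i, c i = 0) /\
  (forall x, exists c : 'I_d -> K, J (x - \sum_i c i *: b i)).

Definition fin_dim_mod (J : L -> Prop) : Prop :=
  exists d, exists b : 'I_d -> L,
    forall x, exists c : 'I_d -> K, J (x - \sum_i c i *: b i).

End LinearAlgebra.

Section Symplectic.
Variables (K : numFieldType) (n : nat).

Definition symplectic_form (Om : 'M[K]_n) : Prop :=
  Om^T = - Om /\ Om \in unitmx.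

Definition finite_subgroup_Sp (Om : 'M[K]_n) (G : {fset 'M[K]_n}) : Prop :=
  [/\ 1%:M \in G,
      forall A B, A \in G -> B \in G -> A *m B \in G,
      forall A, A \in G -> invmx A \in G
    & forall A, A \in G -> A^T *m Om *m A = Om].

(* The function x |-> f (A x). *)
Definition precomp_mx (A : 'M[K]_n) (f : {mpoly K[n]}) : {mpoly K[n]} :=
  f \mPo [tuple \sum_(j < n) A i j *: 'X_j | i < n].

Definition invariant (G : {fset 'M[K]_n}) (f : {mpoly K[n]}) : Prop :=
  forall A, A \in G -> precomp_mx A f = f.

Definition dir_deriv (u : 'rV[K]_n) (f : {mpoly K[n]}) : {mpoly K[n]} :=
  \sum_i u 0 i *: f^`M(i).

(* The vector v' of V with omega(v', x) = v(x), written as a row. *)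
Definition symp_dual (Om : 'M[K]_n) (v : 'rV[K]_n) : 'rV[K]_n :=
  v *m invmx Om.

(* Normalised so that {v, f} = D_{v'} f for a linear function v. *)
Definition poisson (Om : 'M[K]_n) (f h : {mpoly K[n]}) : {mpoly K[n]} :=
  \sum_i \sum_j invmx Om i j *: (f^`M(i) * h^`M(j)).

Definition Jideal (Om : 'M[K]_n) (G : {fset 'M[K]_n}) (v : 'rV[K]_n)
    (p : {mpoly K[n]}) : Prop :=
  exists k, exists a h : 'I_k -> {mpoly K[n]},
    (forall i, invariant G (h i)) /\
    p = \sum_i a i * dir_deriv (symp_dual Om v) (h i).

(* p represents a homogeneous element of K[d_w] / J. *)
Definition homog_mod (J : {mpoly K[n]} -> Prop) (p : {mpoly K[n]}) : Prop :=
  exists d, exists2 e : {mpoly K[n]}, e \is d.-homog & J (p - e).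

(* D_{V^*}: an operator is stored in its normally ordered form
   \sum_m a_m d^m with a_m in O_{V^*}, which determines it uniquely.  The ring
   product of this type is that of symbols, not composition. *)
Definition diffop : Type := {mpoly {mpoly K[n]}[n]}.

Definition dapply (F : diffop) (g : {mpoly K[n]}) : {mpoly K[n]} :=
  \sum_(m <- msupp F) F@_m * g^`M[m].

(* deg 'X_i = -1 for the variables of O_{V^*} and deg d_i = 1. *)
Definition diffop_homog (d : int) (F : diffop) : Prop :=
  forall m k : 'X_{1..n}, m \in msupp F -> k \in msupp F@_m ->
    (mdeg m)%:Z - (mdeg k)%:Z = d.

Definition psymbol (F : diffop) : {mpoly {mpoly K[n]}[n]} :=
  pihomog mdeg (msize F).-1 F.

Definition psymbol_at (v : 'rV[K]_n) (F : diffop) : {mpoly K[n]} :=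
  map_mpoly (meval (fun i => v 0 i)) (psymbol F).

Definition is_lift (Om : 'M[K]_n) (G : {fset 'M[K]_n}) (v : 'rV[K]_n)
    (F : diffop) (f : {mpoly K[n]}) : Prop :=
  Jideal Om G v (psymbol_at v F - f).

(* F_D, with values in the operators with constant coefficients. *)
Definition FD (f : {mpoly K[n]}) : diffop := map_mpoly (@mpolyC n K) f.

Definition pairing (f g : {mpoly K[n]}) : K :=
  (dapply (FD f) g).@[fun=> 0].

Definition HP0_dual (Om : 'M[K]_n) (G : {fset 'M[K]_n})
    (g : {mpoly K[n]}) : Prop :=
  forall h f, invariant G h -> pairing (poisson Om h f) g = 0.

(* The degree i part of O_{V^*}, in its nonpositive grading. *)
Definition in_degree (i : int) (g : {mpoly K[n]}) : Prop :=
  forall m, m \in msupp g -> - (mdeg m)%:Z = i.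

(* hs i is the coefficient of t^i in h(P; t). *)
Definition is_hilbert_series (P : {mpoly K[n]} -> Prop) (hs : int -> nat) :
    Prop :=
  forall i, has_dim (fun g => P g /\ in_degree i g) (hs i).

Definition euler : diffop := - \sum_i ('X_i : {mpoly K[n]}) *: 'X_i.

Lemma dapplywE k (F : diffop) (g : {mpoly K[n]}) : (msize F <= k)%N ->
  dapply F g = \sum_(m : 'X_{1..n < k}) F@_m * g^`M[m].
Proof.
move=> le_Fk; pose I : subFinType _ := 'X_{1..n < k}.
rewrite /dapply (big_mksub I) //=; first last.
- by move=> m /msize_mdeg_lt /leq_trans; apply.
- exact: msupp_uniq.
by rewrite big_rmcond //= => m /memN_msupp_eq0 ->; rewrite mul0r.
Qed.

Lemma dapplyD (E F : diffop) (g : {mpoly K[n]}) :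
  dapply (E + F) g = dapply E g + dapply F g.
Proof.
pose k := maxn (msize (E + F)) (maxn (msize E) (msize F)).
rewrite !(dapplywE (k := k)) ?leq_max ?leqnn ?orbT //.
by rewrite -big_split; apply: eq_bigr => m _; rewrite mcoeffD mulrDl.
Qed.

Lemma dapply0 (g : {mpoly K[n]}) : dapply (0 : diffop) g = 0.
Proof. by rewrite /dapply msupp0 big_nil. Qed.

Lemma dapplyZ (a : {mpoly K[n]}) (F : diffop) (g : {mpoly K[n]}) :
  dapply (a *: F) g = a * dapply F g.
Proof.
pose k := maxn (msize (a *: F)) (msize F).
rewrite !(dapplywE (k := k)) ?leq_max ?leqnn ?orbT // mulr_sumr.
by apply: eq_bigr => m _; rewrite mcoeffZ mulrA.
Qed.

Lemma dapplyX (m : 'X_{1..n}) (g : {mpoly K[n]}) :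
  dapply ('X_[m] : diffop) g = g^`M[m].
Proof. by rewrite /dapply msuppX big_seq1 mcoeffX eqxx mul1r. Qed.

Lemma eulerE (g : {mpoly K[n]}) :
  dapply (euler) g = - \sum_i 'X_i * g^`M(i).
Proof.
rewrite /euler -scaleN1r dapplyZ mulN1r; congr (- _).
rewrite (big_morph (dapply^~ g) (id1 := 0) (op1 := +%R)).
- by apply: eq_bigr => i _; rewrite dapplyZ dapplyX mderivmU1m.
- by move=> E F; exact: dapplyD.
- exact: dapply0.
Qed.

Lemma euler_in_degree (i : int) (g : {mpoly K[n]}) :
  in_degree i g -> dapply (euler) g = i%:~R *: g.
Proof.
move=> g_i; rewrite eulerE.
under eq_bigr do rewrite {1}(mpolyE g) raddf_sum mulr_sumr.
rewrite exchange_big /= [in RHS](mpolyE g) scaler_sumr -sumrN.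
apply: eq_big_seq => m mg; rewrite -(g_i m mg) mulrNz scaleNr; congr (- _).
transitivity (\sum_(j < n) (m j)%:R *: (g@_m *: 'X_[m] : {mpoly K[n]})).
  apply: eq_bigr => j _; rewrite mderivZ mderivX -!scalerAr.
  case: (posnP (m j)) => [-> | m_j]; first by rewrite !scale0r scaler0.
  rewrite -mpolyXD addmC submK ?lep1mP -?lt0n //.
  by rewrite !scalerA mulrC.
by rewrite -scaler_suml -natr_sum -mdegE.
Qed.

Definition eval_line (v : 'rV[K]_n) (c : K) (g : {mpoly K[n]}) : K :=
  g.@[fun i => c * v 0 i].

End Symplectic.

(* Eigenvectors are columns here, while eigenspace uses rows. *)
Definition eigen_dim (K : fieldType) (N : nat) (B : 'M[K]_N) (a : K) : nat :=
  \rank (eigenspace B^T a).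

(* Main.v *)
(* For h invariant and a polynomial a, the operators attached to the brackets
   {h, -} give, on the jet functional D(p) = (p(d) g)(v) of an element g of
   HP_0^*, the relation D(a * D_{v'} h) = D({h, a}); its right-hand side has
   order one less.  By induction on the order, D kills the homogeneous parts of
   J_v, so D is determined by the values F_1 g (v), ..., F_N g (v), and hence so
   is the polynomial g.  When g has degree i, F_k g has degree i + d_k, so that
   the vector of these values is an i-eigenvector of C_xi - Diag(d). *)

From HB Require Import structures.
Require Import Defs.
From mathcomp Require Import all_boot all_order all_algebra finmap.
From mathcomp Require Import complex reals.
From mathcomp Require Import mpoly ring.
From mathcomp Require boolp.

Import GRing.Theory Num.Theory.
Local Open Scope ring_scope.
Local Open Scope complex_scope.

Set Implicit Arguments.
Unset Strict Implicit.
Unset Printing Implicit Defensive.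

(* Locked: otherwise unification unfolds it to its defining sum. *)
HB.lock Definition act (K : numFieldType) (n : nat) (w p : {mpoly K[n]}) :
  {mpoly K[n]} := dapply (FD p) w.
Arguments act {K n} w p.

(** * Constant-coefficient operators acting on polynomials *)

Section ConstantCoefficientOperators.
Variables (K : numFieldType) (n : nat).
Implicit Types (p q a g h w : {mpoly K[n]}) (m : 'X_{1..n}) (E F : diffop K n).

Lemma dapply_linear F : linear (dapply F).
Proof.
move=> c g h; rewrite /dapply scaler_sumr -big_split.
by apply: eq_bigr => m _; rewrite linearP mulrDr scalerAr.
Qed.

HB.instance Definition _ F :=
  GRing.isLinear.Build K _ _ _ (dapply F) (dapply_linear F).

Lemma mcoeff_FD p m : (FD p)@_m = (p@_m)%:MP.
Proof. exact: mcoeff_map_mpoly. Qed.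

Lemma FD_linear (c : K) p q : FD (c *: p + q) = c%:MP *: FD p + FD q.
Proof.
apply/mpolyP => m.
rewrite [RHS]mcoeffD [X in _ = X + _](mcoeffZ c%:MP).
rewrite [LHS]mcoeff_FD [X in _ = _ * X + _]mcoeff_FD [X in _ = _ + X]mcoeff_FD.
by rewrite mcoeffD mcoeffZ mpolyCD mpolyCM.
Qed.

Lemma act_linear w : linear (act w).
Proof.
by move=> c p q; rewrite act.unlock FD_linear dapplyD dapplyZ mul_mpolyC.
Qed.

HB.instance Definition _ w :=
  GRing.isLinear.Build K _ _ _ (act w) (act_linear w).

Lemma actX m w : act w 'X_[m] = w^`M[m].
Proof. by rewrite act.unlock /FD map_mpolyX dapplyX. Qed.

Lemma actDl g h p : act (g + h) p = act g p + act h p.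
Proof. by rewrite act.unlock linearD. Qed.

Lemma actZl c g p : act (c *: g) p = c *: act g p.
Proof. by rewrite act.unlock linearZ. Qed.

Lemma act0l p : act 0 p = 0 :> {mpoly K[n]}.
Proof. by rewrite act.unlock linear0. Qed.

Lemma act_suml (I : finType) (g : I -> {mpoly K[n]}) p :
  act (\sum_i g i) p = \sum_i act (g i) p.
Proof. by rewrite act.unlock linear_sum. Qed.

Lemma actM p q w : act w (p * q) = act (act w q) p.
Proof.
rewrite [p]mpolyE mulr_suml !linear_sum /=; apply: eq_bigr => m _.
rewrite -scalerAl !linearZ /= actX; congr (_ *: _).
rewrite [q]mpolyE mulr_sumr !linear_sum /=. apply: eq_bigr => k _.
by rewrite -scalerAr !linearZ /= -mpolyXD !actX addmC mderivmDm.
Qed.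

(** The commutator of [p(d)] with multiplication by ['X_j] is the operator whose symbol is the
    [j]-th derivative of [p]. The identity is stable under products and linear combinations in [p],
    so the constant 1 and the variables suffice. *)
Lemma act_leibniz p j w :
  act ('X_j * w) p = 'X_j * act w p + act w p^`M(j).
Proof.
pose P p := forall w, act ('X_j * w) p = 'X_j * act w p + act w p^`M(j).
have PM q r : P q -> P r -> P (q * r).
  move=> Pq Pr u; rewrite !actM Pr actDl Pq.
  by rewrite mderivM linearD /= !actM addrA addrAC.
have P1 : P 1.
  by move=> u; rewrite -mpolyX0 !actX !mderivm0m mpolyX0 mderivC linear0 addr0.
have PX i : P 'X_i.
  move=> u; rewrite !actX mderivmU1m mderivM mderivmU1m addrC; congr (_ + _).
  rewrite !mderivX linearZ /= !mnm1E.
  have [->|_] := eqVneq i j; last by rewrite !scale0r mul0r.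
  have -> : (U_(j) - U_(j) = 0 :> 'X_{1..n})%MM.
    by apply/mnmP => k; rewrite mnmBE subnn mnm0E.
  by rewrite actX mderivm0m !scale1r mpolyX0 mul1r.
have PXm m : P 'X_[m].
  rewrite mpolyXE_id; apply: (big_ind P) => // i _.
  by elim: (m i) => [|k IH]; rewrite ?expr0 // exprS; apply: PM.
elim/mpolyind: p => [|c m p _ _ IH].
  by rewrite mderiv0 !linear0 mulr0 addr0.
by rewrite mderivD mderivZ !linearP /= PXm IH scalerDr mulrDr scalerAr addrACA.
Qed.

(** In characteristic zero the Taylor coefficients at any one point determine a polynomial:
    differentiating along the leading monomial leaves a nonzero constant. *)
Lemma mderivm_eval_inj (u : 'I_n -> K) g :
  (forall m, (g^`M[m]).@[u] = 0) -> g = 0.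
Proof.
move=> g0; apply/eqP; apply: contraT => nz_g.
have := g0 (mlead g).
have -> : g^`M[mlead g] =
    (mleadc g *+ \prod_(i < n) (mlead g i)`!)%:MP.
  apply/mpolyP => k; rewrite mcoeff_mderivm mcoeffC.
  have [->|nz_k] := eqVneq k 0%MM.
    rewrite addm0 mulr1; congr (_ *+ _).
    by apply: eq_bigr => i _; rewrite ffactnn.
  rewrite mulr0 memN_msupp_eq0 ?mul0rn //; apply: msize_mdeg_ge.
  by rewrite -mlead_deg // mdegD -addn1 leq_add2l lt0n mdeg_eq0.
move/eqP; rewrite mevalC mulrn_eq0 mleadc_eq0 (negPf nz_g) orbF.
by rewrite -leqn0 leqNgt prodn_gt0 // => i; rewrite fact_gt0.
Qed.

End ConstantCoefficientOperators.

(** * Hamiltonian operators and the relations they impose on [HP0_dual] *)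

Section SymplecticOperators.
Variables (K : numFieldType) (n : nat) (Om : 'M[K]_n) (G : {fset 'M[K]_n}).
Implicit Types (p q a g h w : {mpoly K[n]}) (m : 'X_{1..n}) (u v : 'rV[K]_n).

(* The adjoint of {h, -} for the pairing of O_V with O_{V^*}. *)
Definition ham_op h g : {mpoly K[n]} :=
  \sum_i \sum_j invmx Om i j *: ('X_j * act g h^`M(i)).

Lemma invmx_skew : symplectic_form Om ->
  forall i j, invmx Om i j = - invmx Om j i.
Proof.
case=> skew unitOm i j; have : (invmx Om)^T = - invmx Om.
  rewrite trmx_inv skew -scaleN1r invmxZ ?invrN1 ?scaleN1r //.
  by rewrite -skew unitmx_tr.
by move/matrixP => /(_ j i); rewrite !mxE.
Qed.

(* The case u = 0 is the adjunction with the pairing, as symp_dual vanishes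
   there; the case u = v gives the relations coming from Jideal. *)
Lemma act_ham_op u h g a : symplectic_form Om ->
  (act (ham_op h g) a).@[u 0] =
  (act g (poisson Om h a)).@[u 0] -
  (act g (a * dir_deriv (symp_dual Om u) h)).@[u 0].
Proof.
move/invmx_skew=> skewV.
rewrite /ham_op /poisson /dir_deriv act_suml !linear_sum /=.
rewrite mulr_sumr !linear_sum /= -sumrB; apply: eq_bigr => i _.
move: h^`M(i) => h'; rewrite -scalerAr !linearZ /= /symp_dual.
rewrite act_suml !linear_sum /= mxE mulr_suml -sumrB.
(* Of the two Leibniz terms, the derivative of [a] gives the bracket. In the other, ['X_j] evaluates
   to [u 0 j], and skewness of [invmx Om] turns it into minus the derivative along
   [symp_dual Om u]. *)
apply: eq_bigr => j _; rewrite actZl !linearZ /= act_leibniz !linearD /=.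
rewrite mevalM mevalXU -!actM.
rewrite [invmx Om j i]skewV mulrN mulNr opprK mulrDr addrC [_^`M(j) * _]mulrC.
by rewrite [u _ _ * _ in RHS]mulrC -mulrA.
Qed.

Lemma dir_deriv0 h : dir_deriv 0 h = 0.
Proof. by rewrite /dir_deriv big1 // => i _; rewrite mxE scale0r. Qed.

(** At the origin the directional term of [act_ham_op] drops out, so each Taylor coefficient of
    [ham_op h g] there is, up to a factorial, the functional of [g] on a bracket with [h]. *)
Lemma ham_op_eq0 g h :
  symplectic_form Om -> HP0_dual Om G g -> Defs.invariant G h -> ham_op h g = 0.
Proof.
move=> sympl HPg inv_h; apply: (@mderivm_eval_inj _ _ ((0 : 'rV[K]_n) 0)) => m.
rewrite -actX act_ham_op // /symp_dual mul0mx dir_deriv0 mulr0 linear0 meval0.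
rewrite subr0 -(HPg h 'X_[m] inv_h) /pairing act.unlock.
by apply: meval_eq => i; rewrite mxE.
Qed.

End SymplecticOperators.

(** * Degrees of derivatives, brackets and invariants *)

Section Homogeneity.
Variables (K : numFieldType) (n : nat).
Implicit Types (p q a g h w : {mpoly K[n]}) (m : 'X_{1..n}) (u v : 'rV[K]_n).

(** For [d = 0] the derivative is zero, hence homogeneous of every degree, and the truncated
    predecessor does no harm. *)
Lemma mderiv_homog d i h : h \is d.-homog -> h^`M(i) \is d.-1.-homog.
Proof.
move/dhomogP=> homh; apply/dhomogP => m; rewrite mcoeff_msupp mcoeff_deriv.
rewrite mulrn_eq0 /= -mcoeff_msupp => /homh.
by rewrite /= mdegD mdeg1 addn1 => <-.
Qed.

Lemma dir_deriv_linear u : linear (@dir_deriv K n u).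
Proof.
move=> c g h; rewrite /dir_deriv scaler_sumr -big_split; apply: eq_bigr => i _.
by rewrite mderivD mderivZ scalerDr !scalerA mulrC.
Qed.

HB.instance Definition _ u :=
  GRing.isLinear.Build K _ _ _ (@dir_deriv K n u) (dir_deriv_linear u).

Lemma dir_deriv_homog d u h : h \is d.-homog -> dir_deriv u h \is d.-1.-homog.
Proof.
by move=> homh; apply: rpred_sum => i _; apply/dhomogZ/mderiv_homog.
Qed.

Lemma poisson_homog Om d e h a : h \is d.-homog -> a \is e.-homog ->
  poisson Om h a \is (d.-1 + e.-1).-homog.
Proof.
move=> homh homa; apply: rpred_sum => i _; apply: rpred_sum => j _.
by apply/dhomogZ/dhomogM; apply: mderiv_homog.
Qed.

Lemma poisson1 Om h : poisson Om h 1 = 0.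
Proof.
rewrite /poisson big1 // => i _; rewrite big1 // => j _.
by rewrite mderivC mulr0 scaler0.
Qed.

Lemma precomp_mx_homog (A : 'M[K]_n) m :
  precomp_mx A 'X_[m] \is (mdeg m).-homog.
Proof.
rewrite /precomp_mx comp_mpolyX mdegE.
apply: (big_ind2 (fun p (d : nat) => p \is d.-homog)) => [|p d q e|i _].
- exact: dhomog1.
- exact: dhomogM.
rewrite -[X in X.-homog]mul1n; apply: dhomogMn; rewrite tnth_mktuple.
by apply: rpred_sum => j _; rewrite dhomogZ // dhomogX /= mdeg1.
Qed.

Lemma precomp_mx_pihomog d (A : 'M[K]_n) h :
  precomp_mx A (pihomog mdeg d h) = pihomog mdeg d (precomp_mx A h).
Proof.
rewrite /precomp_mx.
elim/mpolyind: h => [|c m h _ _ IH].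
  by rewrite !linear0.
rewrite !linearP /= IH; congr (_ *: _ + _); rewrite pihomogX.
have homX := precomp_mx_homog A m; have [<-|ne] := eqVneq.
  by rewrite pihomog_dE.
by rewrite linear0 (pihomog_ne0 ne).
Qed.

(** Linear substitutions preserve degree. This allows the generators of [Jideal] to be taken
    homogeneous. *)
Lemma invariant_pihomog (G : {fset 'M[K]_n}) d h :
  Defs.invariant G h -> Defs.invariant G (pihomog mdeg d h).
Proof. by move=> inv_h A GA; rewrite precomp_mx_pihomog inv_h. Qed.

End Homogeneity.

(** * Linear closure of the ideal [Jideal] *)

Section JidealSubspace.
Variables (K : numFieldType) (n : nat) (Om : 'M[K]_n) (G : {fset 'M[K]_n}).
Variable v : 'rV[K]_n.
Local Notation J := (Jideal Om G v).

Lemma Jideal0 : J 0.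
Proof.
exists 0%N, (fun=> 0), (fun=> 0).
by split; [case | rewrite big_ord0].
Qed.

Lemma JidealD p q : J p -> J q -> J (p + q).
Proof.
move=> [k1 [a1 [h1 [inv1 ->]]]] [k2 [a2 [h2 [inv2 ->]]]].
pose glue (b1 : 'I_k1 -> {mpoly K[n]}) b2 (i : 'I_(k1 + k2)) :=
  match split i with inl j => b1 j | inr j => b2 j end.
exists (k1 + k2)%N, (glue a1 a2), (glue h1 h2); split.
  by move=> i; rewrite /glue; case: split.
rewrite big_split_ord /glue; congr (_ + _); apply: eq_bigr => i _.
  case: split_ordP => j /eqP; rewrite ?eq_lrshift //.
  by rewrite (inj_eq (@lshift_inj _ _)) => /eqP->.
case: split_ordP => j /eqP; rewrite ?eq_rlshift //.
by rewrite (inj_eq (@rshift_inj _ _)) => /eqP->.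
Qed.

Lemma JidealZ (c : K) p : J p -> J (c *: p).
Proof.
move=> [k [a [h [inv_h ->]]]]; exists k, (fun i => c *: a i), h; split => //.
by rewrite scaler_sumr; apply: eq_bigr => i _; rewrite scalerAl.
Qed.

Lemma Jideal_sum (I : finType) (p : I -> {mpoly K[n]}) :
  (forall i, J (p i)) -> J (\sum_i p i).
Proof.
by move=> Jp; apply: big_ind => //; [exact: Jideal0 | exact: JidealD].
Qed.

End JidealSubspace.

(** * Induction on the order of the derivatives at [v] *)

Section JetInjectivity.
Variables (K : numFieldType) (n : nat) (Om : 'M[K]_n) (G : {fset 'M[K]_n}).
Variables (v : 'rV[K]_n) (g : {mpoly K[n]}).
Implicit Types (p q a h : {mpoly K[n]}) (m : 'X_{1..n}) (F : diffop K n).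

Definition jets_vanish_below d :=
  forall p e, (e < d)%N -> p \is e.-homog -> (act g p).@[v 0] = 0.

Hypotheses (sympl : symplectic_form Om) (HPg : HP0_dual Om G g).

(** By linearity [p] may be a monomial times the derivative of a homogeneous invariant [h]. Since
    [ham_op h g] is zero, the jet of [g] on this product equals its jet on a bracket, whose degree
    is too low to contribute. *)
Lemma act_pihomog_Jideal d p : jets_vanish_below d ->
  Jideal Om G v p -> (act g (pihomog mdeg d p)).@[v 0] = 0.
Proof.
move=> low [k [a [h [inv_h ->]]]].
rewrite (linear_sum (pihomog mdeg d)) (linear_sum (act g)) linear_sum /=.
apply: big1 => i _; move: (a i) (h i) (inv_h i) => {a inv_h} a {}h inv_h.
rewrite [h](pihomog_partitionE (leqnn (msize h))).
rewrite (linear_sum (dir_deriv _)) mulr_sumr.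
rewrite (linear_sum (pihomog mdeg d)) (linear_sum (act g)) linear_sum /=.
apply: big1 => j _; move: (nat_of_ord j) => {j} e.
have {inv_h} := invariant_pihomog e inv_h.
have := pihomogP mdeg e h; move: (pihomog _ e h) => {}h homh inv_h.
elim/mpolyind: a => [|c m a _ _ IH]; first by rewrite mul0r !linear0.
rewrite mulrDl -scalerAl !linearP /= IH addr0.
have homX : ('X_[m] : {mpoly K[n]}) \is (mdeg m).-homog by rewrite dhomogX.
have homXh := dhomogM homX (dir_deriv_homog (symp_dual Om v) homh).
have [eq_d|ne_d] := eqVneq (mdeg m + e.-1)%N d; last first.
  by rewrite (pihomog_ne0 ne_d homXh) (linear0 (act g)) meval0 mulr0.
rewrite eq_d in homXh; rewrite (pihomog_dE homXh).
have := act_ham_op v h g 'X_[m] sympl.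
rewrite (ham_op_eq0 sympl HPg inv_h) act0l meval0.
move/esym/subr0_eq <-.
(* The degree [e.-1 + (mdeg m).-1] is below [d] only for a nonconstant monomial; the bracket with 1
   is zero. *)
have [m0|nz_m] := eqVneq m 0%MM.
  by rewrite m0 mpolyX0 poisson1 linear0 meval0 mulr0.
rewrite (low _ (e.-1 + (mdeg m).-1)%N) ?mulr0 //; last exact: poisson_homog.
by rewrite -eq_d addnC ltn_add2r prednK // lt0n mdeg_eq0.
Qed.

Lemma psymbol_at_homog F : psymbol_at v F \is ((msize F).-1).-homog.
Proof.
apply/dhomogP => m; rewrite mcoeff_msupp mcoeff_map_mpoly => nz.
have /dhomogP := pihomogP mdeg (msize F).-1 F; apply.
by rewrite mcoeff_msupp; apply: contraNneq nz => ->; rewrite raddf0.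
Qed.

(** The order of a nonzero [F] is [(msize F).-1]. Its terms of lower order involve only derivatives
    of [g] that vanish at [v]. *)
Lemma act_psymbol_at F : jets_vanish_below (msize F).-1 ->
  (act g (psymbol_at v F)).@[v 0] = (dapply F g).@[v 0].
Proof.
move=> low; rewrite /psymbol_at /psymbol pihomogE.
rewrite (raddf_sum (map_mpoly (meval (fun i => v 0 i)))) (linear_sum (act g)).
rewrite raddf_sum /dapply raddf_sum /= big_mkcond /=; apply: eq_big_seq => m mF.
rewrite mevalM; have [_|ne] := eqVneq.
  by rewrite map_mpolyZ map_mpolyX linearZ /= mevalZ actX; congr (_ * _).
rewrite -actX (low _ (mdeg m)) ?mulr0 ?dhomogX //.
rewrite ltn_neqAle ne -ltnS (leq_trans _ (leqSpred _)) //.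
exact: msize_mdeg_lt.
Qed.

(* Only the classes of the symbols at [v] matter: they are homogeneous and
   still form a basis modulo [Jideal], so derivatives of order [d] reduce to the
   values [F i g (v)] and to derivatives of order less than [d]. *)
Lemma lifts_determine N (f : 'I_N -> {mpoly K[n]}) (F : 'I_N -> diffop K n) :
  basis_mod (Jideal Om G v) f -> (forall i, is_lift Om G v (F i) (f i)) ->
  (forall i, (dapply (F i) g).@[v 0] = 0) -> g = 0.
Proof.
move=> [_ span] lift F0; apply: (@mderivm_eval_inj _ _ (v 0)) => m.
rewrite -actX.
have : ('X_[m] : {mpoly K[n]}) \is (mdeg m).-homog by rewrite dhomogX.
move: 'X_[m] (mdeg m) => p d {m}.
have [k] := ubnP d; elim: k => // k IH in d p * => le_dk homp.
have low : jets_vanish_below d.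
  by move=> q e lt_ed; apply: IH; apply: leq_trans lt_ed _.
have [c Jc] := span p; pose s i := psymbol_at v (F i).
have Jq : Jideal Om G v (p - \sum_i c i *: s i).
  rewrite -[p](subrK (\sum_i c i *: f i)) -addrA -sumrB.
  apply: JidealD => //; apply: Jideal_sum => i.
  rewrite -scalerBr -opprB scalerN -scaleNr; apply/JidealZ/lift.
have := act_pihomog_Jideal low Jq; rewrite !linearB /= (pihomog_dE homp).
move/subr0_eq->; rewrite (linear_sum (pihomog mdeg d)) (linear_sum (act g)).
rewrite linear_sum; apply: big1 => i _.
rewrite !linearZ /=; have := psymbol_at_homog (F i); rewrite -/(s i) => homs.
(* Only lifts of order [d] meet the degree [d] component. *)
have [eq_d|ne_d] := eqVneq (msize (F i)).-1 d; last first.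
  by rewrite (pihomog_ne0 ne_d homs) (linear0 (act g)) meval0 mulr0.
by rewrite -eq_d (pihomog_dE homs) act_psymbol_at ?F0 ?mulr0 ?eq_d.
Qed.

End JetInjectivity.

(** * A dimension bound from an injective linear map *)

(** No finite basis of [P] is given in advance. A family in [P] with independent images has at most
    [\rank E] members; one of maximal size is a basis, because [phi] is injective on [P]. *)
Lemma has_dim_le_rank (K : fieldType) (L : lmodType K) (P : L -> Prop)
    (N r : nat) (phi : {linear L -> 'rV[K]_N}) (E : 'M[K]_(r, N)) :
  P 0 -> (forall c x y, P x -> P y -> P (c *: x + y)) ->
  (forall x, P x -> phi x = 0 -> x = 0) ->
  (forall x, P x -> (phi x <= E)%MS) ->
  exists2 d, has_dim P d & (d <= \rank E)%N.
Proof.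
move=> P0 Plin phi_inj phiE.
pose im d (b : 'I_d -> L) := \matrix_(i < d) phi (b i).
(* Excluded middle makes the predicate boolean, as [ex_maxnP] requires. *)
pose free_dim d := boolp.asbool
  (exists b : 'I_d -> L, (forall i, P (b i)) /\ row_free (im d b)).
have free0 : exists d, free_dim d.
  exists 0%N; apply/boolp.asboolP; exists (fun=> 0); split => //.
  by rewrite /row_free -leqn0 rank_leq_row.
have free_le d : free_dim d -> (d <= \rank E)%N.
  case/boolp.asboolP=> b [Pb /eqP rkb]; rewrite -{1}rkb mxrankS //.
  by apply/row_subP => i; rewrite rowK phiE.
case: (ex_maxnP free0 free_le) => d freed d_max.
exists d; last exact: free_le.
case/boolp.asboolP: freed => b [Pb freeb]; exists b.
have im_sum (c : 'I_d -> K) :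
    phi (\sum_i c i *: b i) = (\row_i c i) *m im d b.
  rewrite linear_sum mulmx_sum_row; apply: eq_bigr => i _.
  by rewrite linearZ mxE rowK.
split=> // [c c0 i|x Px].
  have /eqP := im_sum c; rewrite c0 linear0 eq_sym mulmx_free_eq0 //.
  by move/eqP/rowP/(_ i); rewrite !mxE.
have /submxP[c phix] : (phi x <= im d b)%MS.
  (* Otherwise adjoining [x] to [b] would contradict maximality. *)
  apply: contraT => notin.
  pose b' (i : 'I_(1 + d)) := match split i with inl _ => x | inr j => b j end.
  have /d_max : free_dim (1 + d)%N; last by rewrite ltnn.
  apply/boolp.asboolP; exists b'; split.
    by move=> i; rewrite /b'; case: split.
  have -> : im (1 + d)%N b' = col_mx (phi x) (im d b).
    apply/row_matrixP => i; rewrite rowK /b'.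
    case: split_ordP => j ->; rewrite ?rowKu ?rowKd ?rowK //.
    by rewrite [j]ord1; apply/rowP => k; rewrite mxE.
  rewrite /row_free eqn_leq rank_leq_row -addsmxE /=.
  have lt_sum : (im d b < phi x + im d b)%MS.
    by rewrite ltmxE addsmxSr addsmx_sub (negPf notin).
  by rewrite (leq_ltn_trans _ (rank_ltmx lt_sum)) // (eqP freeb).
exists (c 0); apply/eqP; rewrite -subr_eq0; apply/eqP/phi_inj; last first.
  rewrite linearB /= im_sum phix; have -> : \row_i c 0 i = c.
    by apply/rowP => i; rewrite mxE.
  exact: subrr.
rewrite addrC -scaleN1r; apply: (Plin) => //.
apply: big_ind => // [y z Py Pz|i _].
  by rewrite -[y]scale1r; apply: Plin.
by rewrite -[_ *: _]addr0; apply: Plin.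
Qed.

(** * The values of the lifts at [v] as eigenvectors *)

Section LiftValues.
Variables (K : numFieldType) (n : nat).
Implicit Types (g h : {mpoly K[n]}) (v : 'rV[K]_n) (F : diffop K n).

Lemma in_degree_linear i (c : K) g h :
  in_degree i g -> in_degree i h -> in_degree i (c *: g + h).
Proof.
move=> gi hi m; move/msuppD_le; rewrite mem_cat => /orP[/msuppZ_le/gi //|].
exact: hi.
Qed.

Lemma in_degree_sum (I : eqType) (r : seq I) i (p : I -> {mpoly K[n]}) :
  (forall j, j \in r -> in_degree i (p j)) -> in_degree i (\sum_(j <- r) p j).
Proof.
elim: r => [|j r IH] pi; first by rewrite big_nil => m; rewrite msupp0.
rewrite big_cons -[p j]scale1r; apply: in_degree_linear.
  by apply: pi; rewrite mem_head.
by apply: IH => k kr; apply: pi; rewrite inE kr orbT.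
Qed.

Lemma dapply_in_degree i d F g :
  diffop_homog d F -> in_degree i g -> in_degree (i + d) (dapply F g).
Proof.
move=> homF gi; apply: in_degree_sum => m mF k.
case/msuppM_le/allpairsP => /= -[k1 k2] [/= k1F k2g ->].
have /gi <- : (m + k2)%MM \in msupp g.
  move: k2g; rewrite !mcoeff_msupp mcoeff_mderivm mulrn_eq0 negb_or.
  by case/andP.
by rewrite -(homF m k1 mF k1F) !mdegD !PoszD; ring.
Qed.

Lemma HP0_dual_linear (Om : 'M[K]_n) G (c : K) g h :
  HP0_dual Om G g -> HP0_dual Om G h -> HP0_dual Om G (c *: g + h).
Proof.
move=> HPg HPh p q inv_p; rewrite /pairing linearP /= mevalD mevalZ.
by rewrite -!/(pairing _ _) HPg // HPh // mulr0 addr0.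
Qed.

(** A row, to match [eigenspace]; this is why [lift_values_eigen] transposes the matrix. *)
Definition lift_values v N (F : 'I_N -> diffop K n) g : 'rV[K]_N :=
  \row_k (dapply (F k) g).@[v 0].

Lemma lift_values_linear v N (F : 'I_N -> diffop K n) :
  linear (lift_values v F).
Proof.
by move=> c g h; apply/rowP => k; rewrite !mxE linearP /= mevalD mevalZ.
Qed.

HB.instance Definition _ v N (F : 'I_N -> diffop K n) :=
  GRing.isLinear.Build K _ _ _ (lift_values v F) (lift_values_linear v F).

Lemma lift_values_eigen v N (F : 'I_N -> diffop K n) (d : 'I_N -> int)
    (C : 'M[K]_N) i g :
  (forall k, diffop_homog (d k) (F k)) -> in_degree i g ->
  \col_k eval_line v 1 (dapply (euler K n) (dapply (F k) g)) =
    C *m \col_k eval_line v 1 (dapply (F k) g) ->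
  (lift_values v F g <= eigenspace (C - diag_mx (\row_k (d k)%:~R))^T i%:~R)%MS.
Proof.
move=> homF gi /matrixP eulC; apply/eigenspaceP/rowP => k.
have eval1 p : eval_line v 1 p = p.@[v 0].
  by apply: meval_eq => j; rewrite mul1r.
have := eulC k 0; rewrite !mxE (euler_in_degree (dapply_in_degree (homF k) gi)).
(* The Euler field scales [F k g] by [i + d k]; the summand [d k] moves across to become the
   diagonal correction. *)
rewrite eval1 mevalZ intrD mulrDl => /(canRL (addrK _)) ->.
under eq_bigr do rewrite !mxE mulrBr.
rewrite sumrB; congr (_ - _).
  by apply: eq_bigr => j _; rewrite mxE eval1 mulrC.
rewrite (bigD1 k) //= eqxx mulr1n mulrC big1 ?addr0 // => j /negPf ne.
by rewrite eq_sym ne mulr0n mulr0.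
Qed.

End LiftValues.

(** * The Hilbert series, one degree at a time *)

Theorem theorem4p4 (R : realType) (n : nat) (Om : 'M[R[i]]_n)
    (G : {fset 'M[R[i]]_n}) (v : 'rV[R[i]]_n)
    (N : nat) (f : 'I_N -> {mpoly R[i][n]}) (F : 'I_N -> diffop R[i] n)
    (d : 'I_N -> int) (Cxi : 'M[R[i]]_N) :
  (0 < n)%N ->
  symplectic_form Om ->
  finite_subgroup_Sp Om G ->
  fin_dim_mod (Jideal Om G v) ->
  basis_mod (Jideal Om G v) f ->
  (forall i, homog_mod (Jideal Om G v) (f i)) ->
  (forall i, is_lift Om G v (F i) (f i)) ->
  (forall i, diffop_homog (d i) (F i)) ->
  (forall i, 0 <= d i) ->
  (forall g, HP0_dual Om G g -> forall c : R[i],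
     (\col_i eval_line v c (dapply (euler R[i] n) (dapply (F i) g)))
     = Cxi *m (\col_i eval_line v c (dapply (F i) g))) ->
  let Bxi := Cxi - diag_mx (\row_i (d i)%:~R) in
  exists2 hs : int -> nat,
    is_hilbert_series (HP0_dual Om G) hs
    & forall i : int,
        (hs i <= if (i <= 0)%R then eigen_dim Bxi i%:~R else 0)%N.
Proof.
move=> _ sympl _ _ basis_f _ lift_F hom_F _ eulC Bxi.
have hs_ex i : exists k, has_dim (fun g => HP0_dual Om G g /\ in_degree i g) k
    /\ (k <= if (i <= 0)%R then eigen_dim Bxi i%:~R else 0)%N.
  pose E := if (i <= 0)%R then eigenspace Bxi^T i%:~R else 0.
  have [] := @has_dim_le_rank _ _
    (fun g => HP0_dual Om G g /\ in_degree i g) _ _ (lift_values v F) E.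
  - split=> [h p _|m]; last by rewrite msupp0.
    by rewrite /pairing linear0 meval0.
  - move=> c g h [HPg gi] [HPh hi]; split; first exact: HP0_dual_linear.
    exact: in_degree_linear.
  - move=> g [HPg _] g0; apply: (lifts_determine sympl HPg basis_f lift_F) => k.
    by have /rowP/(_ k) := g0; rewrite !mxE.
  - move=> g [HPg gi]; rewrite /E; case: ifPn => [_|i_gt0].
      by apply: lift_values_eigen => //; apply: eulC.
    (* A monomial has degree [- mdeg m], so no nonzero [g] lies in a positive degree. *)
    suff -> : g = 0 by rewrite linear0 sub0mx.
    apply/mpolyP => m; rewrite mcoeff0; apply/memN_msupp_eq0.
    by apply/negP => /gi ei; rewrite -ei oppr_le0 in i_gt0.
  move=> k dim_k le_k; exists k; split => //; move: le_k.
  by rewrite /E /eigen_dim; case: ifP => //; rewrite mxrank0.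
have [hs hsP] := boolp.choice hs_ex.
by exists hs => i; have [] := hsP i.
Qed.
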